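(* Let $T>0$, let $\{P^N,\ N\in\mathbb{N}\}$ be a family of probability measures on $D([0,T],\mathbb{R})$ with canonical coordinate processes $\{Z^N_\cdot,\ N\in\mathbb{N}\}$, and let, for all $N\in\mathbb{N}$, $\{Z^N_t,\ 0\le t\le T\}$ be adapted to the filtration $\{F^N_t,\ 0\le t\le T\}$. Fix $\varepsilon>0$ and suppose that there exist $h_\varepsilon>0$, $N_\varepsilon\in\mathbb{N}$, a deterministic function $\psi_\varepsilon:[0,h_\varepsilon]\to[0,\infty)$ and, for all $N\ge N_\varepsilon$, a deterministic function $\psi^N_\varepsilon:[0,h_\varepsilon]\to[0,\infty)$ and a non-negative value $\phi^N_\varepsilon$ such that, for all $N\ge N_\varepsilon$: (i) the functions $\psi^N_\varepsilon$ are non-decreasing; (ii) for all $h\in[0,h_\varepsilon]$ and $t\in[0,T]$, $P^N\left(|Z^N_{t+h}-Z^N_t|>\varepsilon\,\middle|\,F^N_t\right)\le\psi^N_\varepsilon(h)$, $P^N$-a.s.; (iii) for all $h\in[0,h_\varepsilon]$, $\psi^N_\varepsilon(h)\le\psi_\varepsilon(h)+\phi^N_\varepsilon$; (iv) $\phi^N_\varepsilon\to0$ as $N\to\infty$; (v) $\psi_\varepsilon(h)\to0$ as $h\to0$. Then $$\lim_{\delta\to0}\limsup_{N\to\infty}P^N\left(w'''_{Z^N}(\delta)>4\varepsilon\right)=0.$$ If this is true for all $\varepsilon>0$, then for all $\varepsilon>0$, $$\lim_{\delta\to0}\limsup_{N\to\infty}P^N\left(w'''_{Z^N}(\delta)>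\varepsilon\right)=0.$$
   Context: $D([0,T],\mathbb{R})$ is the Skorokhod space of real-valued càdlàg functions on $[0,T]$. For a bounded function $z:[0,T]\to\mathbb{R}$ and $\delta>0$, the $\delta$-modulus of continuity is $$w'''_z(\delta)=\max\left\{\sup_{\substack{0\le s<t\le T\\ t-s<\delta}}\ \inf_{r\in(s,t)}\max\{w_z(s,r),w_z(r,t)\},\ |z_\delta-z_0|,\ |z_{T^-}-z_{T-\delta}|\right\},$$ where $w_z(s,t)=\sup_{s\le s'\le t'<t}|z_{t'}-z_{s'}|$ and $z_{T^-}$ is the left limit at $T$. This modulus allows for one jump in intervals of size at most $\delta$. Convention: the processes are stopped at time $T$, i.e. $Z^N_t:=Z^N_T$ for $t>T$. *)

(* Defs.v *)
From HB Require Import structures.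
From mathcomp Require Import all_boot all_order all_algebra.
From mathcomp Require Import all_classical all_reals all_analysis.
Set Implicit Arguments.
Unset Strict Implicit.
Unset Printing Implicit Defensive.
Import Order.TTheory GRing.Theory Num.Theory.
Import numFieldNormedType.Exports.
Local Open Scope classical_set_scope.
Local Open Scope ring_scope.

(* D([0, T], R). A path is stored as its unique extension to R that is
   constant on ]-oo, 0] and on [T, +oo[ (last field), so that Leibniz equality
   of [cadlag R T] amounts to equality on [0, T], and the convention that
   processes are stopped at time T is built in. *)
Record cadlag (R : realType) (T : R) := Cadlag {
  path_at :> R -> R ;
  path_right_cont : forall t, 0 <= t < T -> path_at x @[x --> t^'+] --> path_at t ;
  path_left_lim : forall t, 0 < t <= T -> cvg (path_at x @[x --> t^'-]) ;
  path_stopped : forall t, path_at t = path_at (Num.max 0 (Num.min t T)) }.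

Lemma cst0_right_cont (R : realType) (T t : R) : 0 <= t < T ->
  (fun=> 0 : R) x @[x --> t^'+] --> (0 : R).
Proof. by move=> _; exact: cvg_cst. Qed.

Lemma cst0_left_lim (R : realType) (T t : R) : 0 < t <= T ->
  cvg ((fun=> 0 : R) x @[x --> t^'-]).
Proof. by move=> _; exact: is_cvg_cst. Qed.

Definition cadlag0 (R : realType) (T : R) : cadlag T :=
  Cadlag (@cst0_right_cont R T) (@cst0_left_lim R T) (fun=> erefl).

HB.instance Definition _ (R : realType) (T : R) := gen_eqMixin (cadlag T).
HB.instance Definition _ (R : realType) (T : R) := gen_choiceMixin (cadlag T).
HB.instance Definition _ (R : realType) (T : R) :=
  isPointed.Build (cadlag T) (cadlag0 T).

(* An increasing surjection of [0, T] onto itself is a homeomorphism. *)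
Definition time_change (R : realType) (T : R) (lam : R -> R) :=
  {in `[0, T] &, {homo lam : s t / s < t}} /\
  lam @` [set` `[0, T]] = [set` `[0, T]].

(* The J1 ball around [z]. *)
Definition skorokhod_ball (R : realType) (T : R) (z : cadlag T) (e : R) :
    set (cadlag T) :=
  [set y | exists2 lam, time_change T lam &
    forall t, 0 <= t <= T -> `|lam t - t| < e /\ `|y (lam t) - z t| < e].

Definition skorokhod_open (R : realType) (T : R) : set (set (cadlag T)) :=
  [set U | forall z, U z -> exists2 e : R, 0 < e & skorokhod_ball z e `<=` U].

Lemma skorokhod_ball_le (R : realType) (T : R) (z : cadlag T) (d e : R) :
  d <= e -> skorokhod_ball z d `<=` skorokhod_ball z e.
Proof.
move=> de y [lam hlam near_d]; exists lam => // t /near_d[h1 h2].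
by split; [exact: lt_le_trans h1 de|exact: lt_le_trans h2 de].
Qed.

Lemma skorokhod_openT (R : realType) (T : R) : @skorokhod_open R T setT.
Proof. by move=> z _; exists 1. Qed.

Lemma skorokhod_openI (R : realType) (T : R) : setI_closed (@skorokhod_open R T).
Proof.
move=> U V oU oV z [/oU[d d0 dU] /oV[e e0 eV]].
exists (Num.min d e); first by rewrite lt_min d0.
move=> y yz; split.
- by apply: dU; apply: skorokhod_ball_le yz; rewrite ge_min lexx.
- by apply: eV; apply: skorokhod_ball_le yz; rewrite ge_min lexx orbT.
Qed.

Lemma skorokhod_open_bigU (R : realType) (T : R) (I : Type)
    (U : I -> set (cadlag T)) :
  (forall i, skorokhod_open (U i)) -> skorokhod_open (\bigcup_i U i).
Proof.
move=> oU z [i _ /oU[e e0 eU]]; exists e => // y /eU Uy; by exists i.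
Qed.

HB.instance Definition _ (R : realType) (T : R) :=
  isOpenTopological.Build (cadlag T)
    (@skorokhod_openT R T) (@skorokhod_openI R T) (@skorokhod_open_bigU R T).

(* The Skorokhod space with its Borel sigma-algebra. *)
Definition skorokhod (R : realType) (T : R) :=
  g_sigma_algebraType (@open (cadlag T)).

Definition canonical_process (R : realType) (T t : R) (z : skorokhod T) : R :=
  (z : cadlag T) t.
Arguments canonical_process {R} T t z.

Definition is_filtration (d : measure_display) (Om : measurableType d)
    (R : realType) (T : R) (F : R -> set (set Om)) :=
  [/\ forall t, 0 <= t <= T -> sigma_algebra setT (F t),
      forall t, 0 <= t <= T -> F t `<=` measurable &
      forall s t, 0 <= s -> s <= t -> t <= T -> F s `<=` F t].

Definition measurable_wrt (Om : Type) (R : realType) (G : set (set Om))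
    (g : Om -> R) :=
  forall B : set R, measurable B -> G (g @^-1` B).

Definition adapted (Om : Type) (R : realType) (T : R) (F : R -> set (set Om))
    (Z : R -> Om -> R) :=
  forall t, 0 <= t <= T -> measurable_wrt (F t) (Z t).

(* [g] is a version of the conditional probability P(A | G). Versions are
   P-a.s. unique. *)
Definition is_cond_prob (d : measure_display) (Om : measurableType d)
    (R : realType) (P : probability Om R) (G : set (set Om)) (A : set Om)
    (g : Om -> R) :=
  [/\ measurable_wrt G g,
      P.-integrable setT (EFin \o g) &
      forall B, G B -> (\int[P]_(x in B) (g x)%:E = P (A `&` B))%E].

(* P(A | G) <= c, P-almost surely. *)
Definition cond_prob_le (d : measure_display) (Om : measurableType d)
    (R : realType) (P : probability Om R) (G : set (set Om)) (A : set Om)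
    (c : R) :=
  exists2 g, is_cond_prob P G A g & {ae P, forall x, g x <= c}.

Definition oscillation (R : realType) (z : R -> R) (s t : R) : \bar R :=
  ereal_sup [set x | exists s' t',
    [/\ s <= s', s' <= t', t' < t & x = `|z t' - z s'|%:E]].

(* The modulus w'''. For delta > T the last two terms involve values of [z]
   outside [0, T]. *)
Definition modulus (R : realType) (T : R) (z : R -> R) (delta : R) : \bar R :=
  maxe (ereal_sup [set x | exists s t,
          [/\ 0 <= s, s < t, t <= T, t - s < delta &
            x = ereal_inf [set maxe (oscillation z s r) (oscillation z r t) |
                           r in [set` `]s, t[]]]])
    (maxe `|z delta - z 0|%:E
          `|lim (z x @[x --> T^'-]) - z (T - delta)|%:E).

(* Main.v *)
Require Import Defs.
From HB Require Import structures.
From mathcomp Require Import all_boot all_order all_algebra.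
From mathcomp Require Import all_classical all_reals all_analysis.
From mathcomp Require Import measurable_realfun lra.
Import Order.TTheory GRing.Theory Num.Theory.
Import numFieldNormedType.Exports.
Local Open Scope classical_set_scope.
Local Open Scope ring_scope.

(** Why the theorem holds.  Call a time a stop when the path has moved by more
than 2 eps from its position at the previous stop.  Between two consecutive
stops the path oscillates by at most 4 eps, so the interior part of the modulus
can exceed 4 eps only if two consecutive stops are less than delta apart.

Two stops are rarely close.  Let u be a stop and v the next one, with
v < u + delta.  Since Z moved by more than 2 eps from u to v, either
Z (u + delta) is more than eps away from Z u, or it is more than eps away from
Z v.  Conditioning at u in the first case and at v in the second, each has
conditional probability at most psi(delta), so given a stop at u the next one
comes within delta with probability at most 2 psi(delta)
([next_stop_within_le]).

There are few stops on average.  Fix h1 with 4 psi(h1) <= 1.  At most half of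
the stops, on average, are followed by another one within h1; the others are
at most one per window of length h1.  Hence the expected number of stops is at
most 2 K, where K = floor (T / h1) + 1 ([sum_stop_at_le]).  Together these give
probability at most 4 K psi(delta) for two close stops
([grid_two_oscillations]), where K does not depend on N or delta.

The argument is run on finite grids, where stops are genuine stopping times of
the given, possibly not right-continuous, filtration.  What makes grids enough
is a reformulation ([modulus_interior_gtP]): the interior part of the modulus
of a right-continuous path exceeds c if and only if there are rational times
x < y < x' < y' within delta with moves larger than c from x to y and from x'
to y'.  This also shows that the event is measurable, and that it is an
increasing union of events that each involve one finite grid.  Measurability
of the coordinates comes from adaptedness.

The two boundary terms of the modulus are increments over deterministic
intervals, the last one after a passage to the limit at T
([left_end_event_le]).  In total the probability is at most
(4 K + 2) psi_N(delta) ([prob_modulus_le]), and psi_N <= psi + phi_N gives the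
limit. *)

(** * Stops of a discrete path *)

Section LastStop.
Context {R : realType} (a : R) (z : nat -> R).

(** Index 0 is a stop by convention, and an index is a stop exactly when it is
its own last stop. *)
Fixpoint last_stop (k : nat) : nat :=
  if k is k'.+1 then
    if a < `|z k - z (last_stop k')| then k else last_stop k'
  else 0%N.

Local Notation s := last_stop.

Lemma last_stop_le k : (s k <= k)%N.
Proof. by elim: k => //= k IH; case: ifP => // _; exact: leqW. Qed.

Lemma last_stop_homo : {homo s : i j / (i <= j)%N}.
Proof.
apply: homo_leq => //; first by move=> ? ? ?; exact: leq_trans.
by move=> k /=; case: ifP => // _; exact/leqW/last_stop_le.
Qed.

Lemma last_stopS_eq k : (s k.+1 == k.+1) = (a < `|z k.+1 - z (s k)|).
Proof.
rewrite /=; case: ifP => [_|_]; first by rewrite eqxx.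
by apply/negbTE; rewrite neq_ltn ltnS last_stop_le.
Qed.

Lemma last_stop_stop k : s (s k) = s k.
Proof.
by elim: k => //= k IH; case: ifP => //= h; rewrite h.
Qed.

Lemma last_stop_close k : 0 <= a -> `|z k - z (s k)| <= a.
Proof.
move=> a0; case: k => [|k] /=; first by rewrite subrr normr0.
by case: ifPn; rewrite -?leNgt // subrr normr0.
Qed.

Lemma last_stop_mid i j : (s j <= i <= j)%N -> s i = s j.
Proof.
move=> /andP[h1 h2]; apply/eqP; rewrite eqn_leq last_stop_homo//=.
by rewrite -last_stop_stop last_stop_homo.
Qed.

(** Two points that share their last stop are each within [a] of it, so a move
by more than [2 * a] forces a stop strictly after its start. *)
Lemma last_stop_gt i j : (i <= j)%N -> 0 <= a -> 2 * a < `|z j - z i| ->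
  (i < s j)%N.
Proof.
move=> ij a0; rewrite ltnNge; apply: contraTN => h.
have := last_stop_close j a0; have := last_stop_close i a0.
rewrite (@last_stop_mid i j) ?h// -leNgt distrC => h1 h2.
have := ler_distD (z (s j)) (z j) (z i); lra.
Qed.

Lemma next_stop j l : (j <= l)%N -> s l != s j ->
  exists m, [/\ (j <= m < l)%N, s m = s j & s m.+1 = m.+1].
Proof.
elim: l => [|l IH]; first by rewrite leqn0 => /eqP->; rewrite eqxx.
rewrite leq_eqVlt => /predU1P[->|]; first by rewrite eqxx.
rewrite ltnS => jl; have [e|ne] := eqVneq (s l) (s j).
  move=> ne; exists l; rewrite jl ltnS leqnn e; split=> //.
  by move: ne => /=; case: ifP => //; rewrite e eqxx.
move=> _; have [m [/andP[jm ml] h1 h2]] := IH jl ne.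
by exists m; rewrite jm (ltn_trans ml).
Qed.

(** Each of the two moves contains a stop, and these differ because the first
move ends before the second begins.  The conclusion gives a stop [u] in the span
of the moves whose next stop [m.+1] is in it too. *)
Lemma two_oscillations {i j k l} : (i <= j)%N -> (j <= k)%N -> (k <= l)%N ->
  0 <= a -> 2 * a < `|z j - z i| -> 2 * a < `|z l - z k| ->
  exists u m, [/\ (i < u <= m)%N, (m < l)%N, s m = u & s m.+1 = m.+1].
Proof.
move=> ij jk kl a0 dij dkl.
have si := last_stop_gt _ _ ij a0 dij; have sk := last_stop_gt _ _ kl a0 dkl.
have [|m [/andP[jm ml] sm sm1]] := next_stop j l (leq_trans jk kl).
  rewrite gtn_eqF//; apply: leq_ltn_trans (last_stop_le j) _.
  exact: leq_ltn_trans sk.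
by exists (s j), m; rewrite si ml (leq_trans (last_stop_le j)).
Qed.

End LastStop.

(** * Finite unions and monotone limits under a probability *)

Section Probability.
Context {d : measure_display} {Om : measurableType d} {R : realType}.
Variable P : probability Om R.
Local Notation p A := (fine (P A)).

Lemma probE A : measurable A -> P A = (p A)%:E.
Proof. by move=> mA; rewrite fineK// fin_num_measure. Qed.

Lemma prob_ge0 A : 0 <= p A.
Proof. exact: fine_ge0. Qed.

Lemma prob_mono {A B} : measurable A -> measurable B -> A `<=` B -> p A <= p B.
Proof.
move=> mA mB AB; rewrite -lee_fin -!probE//.
by apply: le_measure => //; rewrite inE.
Qed.

Lemma prob_le1 A : measurable A -> p A <= 1.
Proof. by move=> mA; rewrite -lee_fin -probE//; exact: probability_le1. Qed.

Lemma prob_le_setU {A B C} : measurable A -> measurable B -> measurable C ->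
  A `<=` B `|` C -> p A <= p B + p C.
Proof.
move=> mA mB mC ABC; apply: le_trans (prob_mono mA _ ABC) _; first exact: measurableU.
by rewrite -lee_fin EFinD -!probE ?measureU2//; exact: measurableU.
Qed.

Lemma prob_disjoint_bigcup (F : nat -> set Om) n : (forall k, measurable (F k)) ->
  trivIset setT F -> p (\bigcup_(k < n) F k) = \sum_(k < n) p (F k).
Proof.
move=> mF tF; apply: EFin_inj; rewrite bigcup_mkord -probE; last first.
  exact: bigsetU_measurable.
rewrite measure_bigsetU// -sumEFin; apply: eq_bigr => k _; exact: probE.
Qed.

Lemma prob_le_bigcup {F : nat -> set Om} {A n} : measurable A ->
  (forall k, measurable (F k)) ->
  A `<=` \bigcup_(k < n) F k -> p A <= \sum_(k < n) p (F k).
Proof.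
move=> mA mF AF; rewrite -lee_fin -probE// -sumEFin.
rewrite (eq_bigr (fun k : 'I_n => P (F k))); last by move=> k _; exact/esym/probE.
by apply: content_subadditive => //; rewrite -bigcup_mkord.
Qed.

Lemma nondecreasing_bigcup_le (F : nat -> set Om) (c : \bar R) :
  (forall k, measurable (F k)) ->
  {homo F : n m / (n <= m)%N >-> n `<=` m} ->
  (forall k, P (F k) <= c)%E -> (P (\bigcup_k F k) <= c)%E.
Proof.
move=> mF hF Fc; have mU := bigcupT_measurable F mF.
have cF := @nondecreasing_cvg_mu _ _ _ P F mF mU.
have {}cF : (P \o F) x @[x --> \oo] --> P (\bigcup_k F k).
  by apply: cF => n m /hF /subsetPset.
rewrite -(cvg_lim (@ereal_hausdorff R) cF).
apply: lime_le; first by apply/cvg_ex; eexists; exact: cF.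
exact: nearW.
Qed.

(** The form in which conditional bounds are used: the version [g] is replaced
by the constant [c] off the null set where it exceeds [c], which belongs to [G]
because [g] is [G]-measurable. *)
Lemma cond_prob_le_setI (G : set (set Om)) (A B : set Om) (c : R) :
  G `<=` measurable -> measurable A -> G B -> 0 <= c ->
  cond_prob_le P G A c -> p (A `&` B) <= c * p B.
Proof.
move=> Gm mA GB c0 [g [mg ig gE] gc]; have mB := Gm _ GB.
pose N := [set x | c < g x].
have mN : measurable N.
  have -> : N = g @^-1` `]c, +oo[.
    by apply/seteqP; split=> x /=; rewrite in_itv/= andbT.
  by apply: Gm; apply: mg; exact: measurable_itv.
have PN : P N = 0.
  apply/(negligibleP _ mN); apply: negligibleS gc => x /= cg.
  by apply/negP; rewrite -ltNge.
have mBN : measurable (B `\` N) by exact: measurableD.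
rewrite -lee_fin EFinM -!probE//; last exact: measurableI.
rewrite -gE// (@negligible_integral _ _ _ _ _ N)//; last first.
  by apply: integrableS ig.
apply: (@le_trans _ _ (\int[P]_(x in B `\` N) (cst c%:E x))%E).
  apply: le_integral => //.
  - by apply: integrableS ig.
  - exact: finite_measure_integrable_cst.
  - by move=> x /set_mem[_ /= /negP]; rewrite -leNgt lee_fin.
rewrite integral_cst// lee_wpmul2l//.
by apply: le_measure => //; rewrite ?inE//; exact: subDsetl.
Qed.

End Probability.

(** * Events of a sub-sigma-algebra *)

(** Transfers the closure properties of measurable sets to a sigma-algebra given
as a set of sets. *)
Lemma measurable_g_sigma {Om : pointedType} {G : set (set Om)} :
  sigma_algebra setT G ->
  forall A : set Om, G A <-> measurable (A : set (g_sigma_algebraType G)).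
Proof. by move=> sG A; rewrite /measurable/= (sigma_algebra_id sG). Qed.

Lemma measurable_far (d : measure_display) (Om : measurableType d)
    (R : realType) (c : R) (X Y : Om -> R) :
  measurable_fun setT X -> measurable_fun setT Y ->
  measurable [set w | c < `|X w - Y w|].
Proof.
move=> mX mY; rewrite -[X in measurable X]setTI.
have mXY : measurable_fun setT (fun w => `|X w - Y w|).
  by apply: measurableT_comp => //; exact: measurable_funB.
exact: (measurable_fun_ltr (measurable_cst c) mXY measurableT (Y := [set true])).
Qed.

Lemma sigma_algebra_far {Om : pointedType} {R : realType} {G : set (set Om)}
    {X Y : Om -> R} (c : R) : sigma_algebra setT G ->
  measurable_wrt G X -> measurable_wrt G Y -> G [set w | c < `|X w - Y w|].
Proof.
move=> sG mX mY; apply/(measurable_g_sigma sG).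
apply: (@measurable_far _ (g_sigma_algebraType G)) => _ B mB; rewrite setTI.
  by apply/(measurable_g_sigma sG)/mX.
by apply/(measurable_g_sigma sG)/mY.
Qed.

Lemma sigma_algebraI {Om : pointedType} {G : set (set Om)} {A B : set Om} :
  sigma_algebra setT G -> G A -> G B -> G (A `&` B).
Proof.
move=> sG /(measurable_g_sigma sG) mA /(measurable_g_sigma sG) mB.
by apply/(measurable_g_sigma sG); exact: measurableI.
Qed.

Lemma sigma_algebraD {Om : pointedType} {G : set (set Om)} {A B : set Om} :
  sigma_algebra setT G -> G A -> G B -> G (A `\` B).
Proof.
move=> sG /(measurable_g_sigma sG) mA /(measurable_g_sigma sG) mB.
by apply/(measurable_g_sigma sG); exact: measurableD.
Qed.

Lemma sigma_algebra_bigU {Om : pointedType} {G : set (set Om)}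
    {A : nat -> set Om} n :
  sigma_algebra setT G -> (forall k, (k < n)%N -> G (A k)) ->
  G (\bigcup_(k < n) A k).
Proof.
move=> sG mA; apply/(measurable_g_sigma sG).
rewrite bigcup_mkord; apply: bigsetU_measurable => i _.
by apply/(measurable_g_sigma sG)/mA.
Qed.

(** * Stops along a finite grid *)

(** Uniform in the length of the increment up to [h]; this monotone form allows
an increment that starts at a random time and ends at a fixed one. *)
Definition small_increments {d : measure_display} {Om : measurableType d}
    {R : realType} (P : probability Om R) (T : R) (F : R -> set (set Om))
    (Z : R -> Om -> R) (eps h alpha : R) :=
  forall u v B, 0 <= u <= T -> u <= v <= u + h -> F u B ->
    fine (P ([set w | eps < `|Z v w - Z u w|] `&` B)) <= alpha * fine (P B).

Section Grid.
Context (d : measure_display) (Om : measurableType d) (R : realType).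
Context (P : probability Om R) (T : R) (F : R -> set (set Om)).
Context (Z : R -> Om -> R) (eps : R) (t : nat -> R).
Hypothesis F_filtration : is_filtration T F.
Hypothesis Z_adapted : adapted T F Z.
Hypothesis mZ : forall v, measurable_fun setT (Z v).
Hypothesis eps_ge0 : 0 <= eps.
Hypothesis t_homo : {homo t : i j / (i <= j)%N >-> i <= j}.
Hypothesis t_range : forall i, 0 <= t i <= T.
Local Notation p A := (fine (P A)).

Definition grid_stop (w : Om) := last_stop (2 * eps) (fun i => Z (t i) w).

Definition stopped_from k u := [set w | grid_stop w k = u].

Definition stop_at u := stopped_from u u.

(** The index [u] is a stop and [k.+1] is the next one. *)
Definition next_stop_at u k := stopped_from k u `&` stop_at k.+1.

(** As a union over all [k < n] of sets that are empty when [t k.+1] is too late,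
so that the pieces are disjoint without any condition on [k]. *)
Definition next_stop_within n u h :=
  \bigcup_(k < n) (if t k.+1 < t u + h then next_stop_at u k else set0).

Lemma filtration_sigma i : sigma_algebra setT (F (t i)).
Proof. by have [+ _ _] := F_filtration; apply. Qed.

Lemma filtration_measurable i A : F (t i) A -> measurable A.
Proof. by have [_ + _] := F_filtration; apply. Qed.

Lemma filtration_grid_homo i j A : (i <= j)%N -> F (t i) A -> F (t j) A.
Proof.
move=> ij; have [_ _] := F_filtration; apply; last by have /andP[] := t_range j.
  by have /andP[] := t_range i.
exact: t_homo.
Qed.

(** Stops are stopping times: [u] is the last stop at [k.+1] either because
[k.+1] is a new stop, which is decided by comparing with the value at each
possible last stop, or because [u] was the last stop at [k] and [k.+1] is
not a new one. *)
Lemma stopped_from_F k u : F (t k) (stopped_from k u).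
Proof.
elim: k u => [|k IH] u.
  have [F0 FC _] := filtration_sigma 0.
  case: u => [|u].
    rewrite (_ : stopped_from _ _ = setT `\` set0); first exact: FC.
    by apply/seteqP; split => // x _; split.
  by rewrite (_ : stopped_from _ _ = set0)//; apply/seteqP; split.
pose D j := stopped_from k j `&` [set w | 2 * eps < `|Z (t k.+1) w - Z (t j) w|].
have DF : F (t k.+1) (\bigcup_(j < k.+1) D j).
  apply: sigma_algebra_bigU => [|j]; first exact: filtration_sigma.
  rewrite ltnS => jk; apply: sigma_algebraI; first exact: filtration_sigma.
    by apply: filtration_grid_homo (IH _); exact: leqnSn.
  apply: sigma_algebra_far; first exact: filtration_sigma.
    by apply: Z_adapted.
  by move=> B mB; apply: (filtration_grid_homo j) (leqW jk) _; apply: Z_adapted.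
have DE w : (\bigcup_(j < k.+1) D j) w <-> grid_stop w k.+1 == k.+1.
  rewrite [in X in _ <-> X]/grid_stop last_stopS_eq; split.
    by move=> [j _ [<- /=]].
  move=> h; exists (grid_stop w k) => //=.
  by rewrite ltnS; exact: last_stop_le.
have [->|uk] := eqVneq u k.+1.
  rewrite (_ : stopped_from _ _ = \bigcup_(j < k.+1) D j)//.
  by apply/seteqP; split => w => [/eqP/DE|/DE/eqP].
rewrite (_ : stopped_from _ _ = stopped_from k u `\` \bigcup_(j < k.+1) D j).
  apply: sigma_algebraD => //; first exact: filtration_sigma.
  by apply: filtration_grid_homo (IH _); exact: leqnSn.
have E w : ~ (\bigcup_(j < k.+1) D j) w -> grid_stop w k.+1 = grid_stop w k.
  move=> /DE /negP; rewrite /grid_stop last_stopS_eq => h.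
  by rewrite /= (negbTE h).
apply/seteqP; split => w.
  rewrite /stopped_from /mkset => h; have nD : ~ (\bigcup_(j < k.+1) D j) w.
    by move=> /DE /eqP h'; move: uk; rewrite -h' -[in X in X != _]h eqxx.
  by split => //; rewrite /mkset -E.
by move=> [h nD]; rewrite /stopped_from /mkset E.
Qed.

Lemma next_stop_at_F u k : F (t k.+1) (next_stop_at u k).
Proof.
apply: sigma_algebraI; [exact: filtration_sigma| |exact: stopped_from_F].
by apply: filtration_grid_homo (stopped_from_F _ _); exact: leqnSn.
Qed.

Lemma next_stop_at_far u k w : next_stop_at u k w ->
  2 * eps < `|Z (t k.+1) w - Z (t u) w|.
Proof.
by move=> [/= <- /eqP]; rewrite /grid_stop last_stopS_eq.
Qed.

Lemma next_stop_at_le u k w : next_stop_at u k w -> (u <= k)%N.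
Proof. by move=> [/= <- _]; exact: last_stop_le. Qed.

Lemma next_stop_at_stop u k : next_stop_at u k `<=` stop_at u.
Proof. by move=> w [/= <- _]; exact: last_stop_stop. Qed.

Lemma next_stop_at_disj u : trivIset setT (next_stop_at u).
Proof.
have H k k' w : (k < k')%N -> next_stop_at u k w -> next_stop_at u k' w -> False.
  move=> kk' Ck; have uk := next_stop_at_le _ _ _ Ck.
  case: Ck => _ sk [sk' _].
  have : (grid_stop w k.+1 <= grid_stop w k')%N by exact: last_stop_homo.
  by rewrite (sk : grid_stop w k.+1 = _) (sk' : grid_stop w k' = _) leqNgt ltnS uk.
move=> k k' _ _ [w [Ck Ck']]; case: (ltngtP k k') => // kk'.
  by case: (H _ _ _ kk' Ck Ck').
by case: (H _ _ _ kk' Ck' Ck).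
Qed.

Let G u h k := if t k.+1 < t u + h then next_stop_at u k else set0.

Let mG u h k : measurable (G u h k).
Proof.
by rewrite /G; case: ifP => // _; apply: filtration_measurable (next_stop_at_F u k).
Qed.

Let tG u h B : trivIset setT (fun k => G u h k `&` B).
Proof.
move=> i j _ _ [w [[+ _] [+ _]]]; rewrite /G; case: ifP => // _ Gi.
by case: ifP => // _ Gj; apply: (next_stop_at_disj u) => //; exists w.
Qed.

Lemma next_stop_within_meas n u h : measurable (next_stop_within n u h).
Proof.
rewrite /next_stop_within bigcup_mkord.
by apply: bigsetU_measurable => k _; exact: mG.
Qed.

(** Let [A] be the event that the increment from [t u] to [t u + h] is large.
Inside [A] the conditional bound at [t u] applies.  Outside [A], the value at
[t u + h] is close to the value at the stop [u], hence far from the value at the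
next stop [k.+1], and the conditional bound at [t k.+1] applies; summing it over
the disjoint possibilities for [k] costs [alpha] times the probability of the
event itself, which is at most that of a stop at [u]. *)
Lemma next_stop_within_le n u h alpha : 0 <= h -> 0 <= alpha ->
  small_increments P T F Z eps h alpha ->
  p (next_stop_within n u h) <= 2 * alpha * p (stop_at u).
Proof.
move=> h0 a0 small.
pose A := [set w | eps < `|Z (t u + h) w - Z (t u) w|].
have mA : measurable A by exact: measurable_far.
have mS : measurable (stop_at u) by exact: filtration_measurable (stopped_from_F u u).
have mH := next_stop_within_meas n u h.
have HS : next_stop_within n u h `<=` stop_at u.
  by move=> w [k _]; case: ifP => // _ /next_stop_at_stop.
have step k : p (G u h k `&` ~` A) <= alpha * p (G u h k).
  rewrite /G; case: ifPn => [tk|_]; last first.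
    by rewrite set0I measure0 mulr0.
  have [uk|/negP uk] := boolP (u <= k)%N; last first.
    rewrite (_ : next_stop_at u k = set0) ?set0I ?measure0 ?mulr0//.
    by apply/seteqP; split => // w /next_stop_at_le /uk.
  have FC := next_stop_at_F u k; have mC := filtration_measurable _ _ FC.
  apply: le_trans (small (t k.+1) (t u + h) _ _ _ FC); last 2 first.
  - exact: t_range.
  - by rewrite (ltW tk) lerD2r t_homo// leqW.
  apply: prob_mono.
  - by apply: measurableI => //; exact: measurableC.
  - by apply: measurableI => //; exact: measurable_far.
  - move=> w [Cw /= nA]; split => //=; rewrite ltNge; apply/negP => close.
    apply: nA; have := next_stop_at_far _ _ _ Cw.
    have := ler_distD (Z (t u + h) w) (Z (t k.+1) w) (Z (t u) w).
    rewrite (distrC (Z (t k.+1) w) (Z (t u + h) w)).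
    rewrite /A/=; lra.
have HA : p (next_stop_within n u h) <=
    p (A `&` stop_at u) + p (\bigcup_(k < n) (G u h k `&` ~` A)).
  apply: prob_le_setU => //.
  - exact: measurableI.
  - rewrite bigcup_mkord; apply: bigsetU_measurable => k _.
    by apply: measurableI => //; exact: measurableC.
  - move=> w Hw; have [Aw|nAw] := pselect (A w); [left|right].
      by split => //; exact: HS.
    by case: Hw => k kn Gk; exists k.
have HB : p (\bigcup_(k < n) (G u h k `&` ~` A)) <=
    alpha * p (next_stop_within n u h).
  rewrite prob_disjoint_bigcup; last exact: tG; last first.
    by move=> k; apply: measurableI => //; exact: measurableC.
  rewrite /next_stop_within prob_disjoint_bigcup; [|exact: mG|]; last first.
    by have := tG u h setT; under [X in trivIset _ X]eq_fun do rewrite setIT.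
  by rewrite mulr_sumr; apply: ler_sum => k _; exact: step.
have tu : t u <= t u + h <= t u + h by rewrite lerDl h0 lexx.
have := small _ _ _ (t_range u) tu (stopped_from_F u u).
have := ler_wpM2l a0 (prob_mono P mH mS HS).
rewrite -/A -/(stop_at u); lra.
Qed.

(** [M <= 2^-1 * M + K.+1], where [M] is the expected number of stops: a stop is
followed by another one within [h] with conditional probability at most
[2 * alpha <= 2^-1], and of the stops that are not ([L u]), no two lie in the
same window of length [h], since the first would have a next stop in time.  The
windows [win] are those of the quotient [t u / h]. *)
Lemma sum_stop_at_le n h alpha : 0 < h -> 0 <= alpha -> 4 * alpha <= 1 ->
  small_increments P T F Z eps h alpha ->
  \sum_(u < n.+1) p (stop_at u) <= 2 * (Num.truncn (T / h)).+1%:R.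
Proof.
move=> h0 a0 a1 small; set K := Num.truncn _.
pose L u := stop_at u `\` next_stop_within n u h.
have mS u : measurable (stop_at u) by exact: filtration_measurable (stopped_from_F u u).
have mL u : measurable (L u).
  by apply: measurableD => //; exact: next_stop_within_meas.
pose win u : 'I_K.+1 := inord (Num.truncn (t u / h)).
have th_ge0 u : 0 <= t u / h.
  by have /andP[tu _] := t_range u; rewrite divr_ge0// ltW.
have win_close u v : win u = win v -> t v < t u + h.
  have winE x : (win x : nat) = Num.truncn (t x / h).
    rewrite inordK// ltnS; apply: le_truncn.
    by have /andP[_ tx] := t_range x; rewrite ler_pM2r ?invr_gt0.
  move=> /(congr1 val) /=; rewrite !winE => E.
  have /andP[_ h2] := truncn_itv (th_ge0 v).
  have /andP[h1 _] := truncn_itv (th_ge0 u).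
  move: h1 h2; rewrite E -natr1 => h1 h2.
  have hV : 0 < h^-1 by rewrite invr_gt0.
  have hh : h / h = 1 by rewrite divff// gt_eqF.
  by rewrite -(ltr_pM2r hV) mulrDl hh; lra.
have L_disj u v w : (u < v)%N -> (v <= n)%N -> win u = win v ->
    L u w -> L v w -> False.
  move=> uv vn /win_close tuv [Su nu] [Sv _]; apply: nu.
  rewrite /stop_at /stopped_from /mkset in Su Sv.
  have [|m [/andP[um mv] sm sm1]] := next_stop (2 * eps) (fun i => Z (t i) w)
    _ _ (ltnW uv).
    by rewrite -/(grid_stop w v) -/(grid_stop w u) Su Sv gtn_eqF.
  exists m => /=; first exact: leq_trans vn.
  rewrite (le_lt_trans _ tuv); last exact: t_homo.
  by split => //; exact: etrans sm Su.
have window (j : 'I_K.+1) : \sum_(u < n.+1 | win u == j) p (L u) <= 1.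
  pose D u := if (u <= n)%N && (win u == j) then L u else set0.
  have mD u : measurable (D u) by rewrite /D; case: ifP.
  rewrite (_ : \sum_(u < n.+1 | _) _ = \sum_(u < n.+1) p (D u)).
    rewrite -prob_disjoint_bigcup//.
      by apply: prob_le1; rewrite bigcup_mkord; exact: bigsetU_measurable.
    move=> u v _ _ [w []]; rewrite /D.
    case: ifP => // /andP[un /eqP wu] Lu; case: ifP => // /andP[vn /eqP wv] Lv.
    case: (ltngtP u v) => // uv; exfalso.
      by apply: (L_disj u v w) => //; rewrite wv.
    by apply: (L_disj v u w) => //; rewrite wv.
  rewrite big_mkcond; apply: eq_bigr => u _; rewrite /D -ltnS ltn_ord/=.
  by case: ifP => // _; rewrite measure0.
have total : \sum_(u < n.+1) p (L u) <= K.+1%:R.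
  rewrite (partition_big (fun u : 'I_n.+1 => win u) xpredT)//=.
  apply: le_trans (ler_sum _ (fun j _ => window j)) _.
  by rewrite sumr_const card_ord.
have split_stop u : p (stop_at u) <= 2^-1 * p (stop_at u) + p (L u).
  apply: (@le_trans _ _ (p (next_stop_within n u h) + p (L u))).
    apply: prob_le_setU => //; first exact: next_stop_within_meas.
    by move=> w Sw; have [?|?] := pselect (next_stop_within n u h w); [left|right].
  rewrite lerD2r (le_trans (next_stop_within_le n u _ _ (ltW h0) a0 small))//.
  by apply: ler_wpM2r; [exact: prob_ge0|lra].
have : \sum_(u < n.+1) p (stop_at u) <=
    2^-1 * (\sum_(u < n.+1) p (stop_at u)) + \sum_(u < n.+1) p (L u).
  by rewrite mulr_sumr -big_split; apply: ler_sum => u _; exact: split_stop.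
lra.
Qed.

(** With stops at distance [2 * eps], two moves by more than [4 * eps] within time
[h] require a stop whose next stop comes within [h]; the union bound over the
possible positions of that stop is controlled by the expected number of
stops. *)
Lemma grid_two_oscillations n h alpha h1 alpha1 A :
  0 <= h -> 0 <= alpha -> small_increments P T F Z eps h alpha ->
  0 < h1 -> 0 <= alpha1 -> 4 * alpha1 <= 1 ->
  small_increments P T F Z eps h1 alpha1 ->
  measurable A ->
  (forall w, A w -> exists i j k l, [/\ [&& i <= j, j <= k, k <= l & l <= n]%N,
     4 * eps < `|Z (t j) w - Z (t i) w|, 4 * eps < `|Z (t l) w - Z (t k) w| &
     t l < t i + h]) ->
  p A <= 4 * (Num.truncn (T / h1)).+1%:R * alpha.
Proof.
move=> h0 a0 small h10 a10 a1 small1 mA AE.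
have Asub : A `<=` \bigcup_(u < n.+1) next_stop_within n u h.
  move=> w /AE [i [j [k [l [/and4P[ij jk kl ln] dij dkl til]]]]].
  have e2 : 0 <= 2 * eps by rewrite mulr_ge0.
  have E : 2 * (2 * eps) = 4 * eps by lra.
  have [||u [m [/andP[iu um] ml sm sm1]]] :=
    two_oscillations (2 * eps) (fun i => Z (t i) w) ij jk kl e2.
  - by rewrite E.
  - by rewrite E.
  have mn := leq_trans ml ln.
  exists u => /=; first exact: leq_ltn_trans um (leqW mn).
  exists m => //=; rewrite (le_lt_trans (t_homo _ _ ml))//.
  by rewrite (lt_le_trans til)// lerD2r t_homo// ltnW.
have := sum_stop_at_le n _ _ h10 a10 a1 small1.
have := prob_le_bigcup P mA (fun u => next_stop_within_meas n u h) Asub.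
have : \sum_(u < n.+1) p (next_stop_within n u h) <=
    2 * alpha * \sum_(u < n.+1) p (stop_at u).
  by rewrite mulr_sumr; apply: ler_sum => u _; exact: next_stop_within_le.
set M := \sum_(u < n.+1) p (stop_at u); set K := _.+1%:R.
move=> H1 H2 H3; apply: (le_trans H2); apply: (le_trans H1).
have := ler_wpM2l (mulr_ge0 (ler0n R 2) a0) H3; lra.
Qed.

End Grid.

(** * The modulus of a right-continuous path *)

Lemma rat_near_right {R : realType} {x : R} {Q : R -> Prop} :
  (\forall y \near x^'+, Q y) -> exists2 q : rat, x < ratr q & Q (ratr q).
Proof.
move=> [e /= e0 he]; have [q] : exists q : rat, ratr q \in `]x, (x + e)[.
  by apply: rat_in_itvoo; rewrite ltrDl.
rewrite in_itv/= => /andP[xq qe]; exists q => //; apply: he => //=.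
by rewrite ltr0_norm ?subr_lt0// opprB ltrBlDl.
Qed.

Lemma far_right {R : realType} {f : R -> R} {x a b c : R} :
  f y @[y --> x^'+] --> f x -> x < b -> c < `|f x - a| ->
  exists q : rat, x < ratr q < b /\ c < `|f (ratr q) - a|.
Proof.
move=> fx xb far.
have h1 : \forall y \near x^'+, y < b by exact: nbhs_right_lt.
have h2 : \forall y \near x^'+, c < `|f y - a|.
  have : `|f y - a| @[y --> x^'+] --> `|f x - a|.
    by apply: cvg_norm; apply: cvgB => //; exact: cvg_cst.
  by move=> /cvgr_gt; apply.
have [q xq [qb h]] := rat_near_right (filterI h1 h2).
by exists q; rewrite xq.
Qed.

Lemma oscillation_gtP {R : realType} (f : R -> R) (s t c : R) :
  (c%:E < oscillation f s t)%E <->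
  exists x y, [/\ s <= x, x <= y, y < t & c < `|f y - f x|].
Proof.
split=> [/ereal_sup_gt[_ [x [y [sx xy yt ->]]]]|[x [y [sx xy yt h]]]].
  by rewrite lte_fin => h; exists x, y.
apply: (@lt_le_trans _ _ `|f y - f x|%:E); first by rewrite lte_fin.
by apply: ereal_sup_ubound; exists x, y.
Qed.

Definition double_oscillation {R : realType} (T delta c : R) (f : R -> R)
    (x y x' y' : R) :=
  [/\ [&& 0 <= x, x < y, y < x', x' < y' & y' < T], y' < x + delta,
    c < `|f y - f x| & c < `|f y' - f x'|].

(** The first of the three terms of [modulus]. *)
Definition modulus_interior {R : realType} (T : R) (f : R -> R) (delta : R) :=
  ereal_sup [set x | exists s t,
    [/\ 0 <= s, s < t, t <= T, t - s < delta &
      x = ereal_inf [set maxe (oscillation f s r) (oscillation f r t) |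
                     r in [set` `]s, t[]]]].

Section Paths.
Context {R : realType} (T : R) (f : R -> R).
Hypothesis f_right : forall t, 0 <= t < T -> f x @[x --> t^'+] --> f t.

(** Let [rho] be the largest time before which, from [s] on, [f] oscillates by at
most [c].  It is after [s] by right continuity at [s], and before [t], since
otherwise the midpoint would be a good splitting point.  As [rho] is not one
either, a move larger than [c] occurs from [rho] on, before [t].  Right continuity at [rho]
lets it start strictly after [rho], at [x1], and then by maximality of [rho]
another move larger than [c] is completed before [x1]. *)
Lemma unsplittable_double (s t c : R) : 0 <= s -> s < t -> t <= T -> 0 < c ->
  (forall r, s < r < t ->
    (c%:E < maxe (oscillation f s r) (oscillation f r t))%E) ->
  exists x y x' y', [/\ [&& s <= x, x < y, y < x', x' < y' & y' < t],
    c < `|f y - f x| & c < `|f y' - f x'|].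
Proof.
move=> s0 st tT c0 bad.
pose good r := forall x y, s <= x -> x <= y -> y < r -> `|f y - f x| <= c.
have not_good r : ~ good r ->
    exists x y, [/\ s <= x, x < y, y < r & c < `|f y - f x|].
  move=> ng; apply: contrapT => H; apply: ng => x y sx xy yr.
  rewrite leNgt; apply/negP => h; apply: H; exists x, y; split => //.
  rewrite lt_neqAle xy andbT; apply: contraTN h => /eqP->.
  by rewrite subrr normr0 -leNgt ltW.
have badP r : s < r < t -> good r ->
    exists x y, [/\ r <= x, x < y, y < t & c < `|f y - f x|].
  move=> rst gr; have := bad _ rst; rewrite lt_max => /orP[|]/oscillation_gtP.
    by move=> [x [y [sx xy yr]]]; rewrite ltNge gr.
  move=> [x [y [sx xy yr h]]]; exists x, y; split => //.
  rewrite lt_neqAle xy andbT; apply: contraTN h => /eqP->.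
  by rewrite subrr normr0 -leNgt ltW.
pose A := [set r | s < r <= t /\ good r].
have [r0 [Ar0 sr0]] : exists r0, A r0 /\ s < r0.
  have : f x @[x --> s^'+] --> f s by apply: f_right; rewrite s0 (lt_le_trans st).
  move=> /cvgrPdist_le /(_ (c / 2)) []; first by rewrite divr_gt0.
  move=> e /= e0 he; pose r0 := Num.min t (s + e).
  have sr0 : s < r0 by rewrite lt_min st ltrDl.
  exists r0; split=> //; split; first by rewrite sr0 ge_min lexx.
  have close x : s <= x -> x < r0 -> `|f s - f x| <= c / 2.
    rewrite le_eqVlt => /predU1P[<-|sx xr]; first by rewrite subrr normr0 divr_ge0// ltW.
    apply: he => //=; rewrite ltr0_norm ?subr_lt0// opprB ltrBlDl.
    by move: xr; rewrite lt_min => /andP[].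
  move=> x y sx xy yr.
  have := close x sx (le_lt_trans xy yr); have := close y (le_trans sx xy) yr.
  have := ler_distD (f s) (f y) (f x); rewrite (distrC (f y) (f s)); lra.
have ubA : ubound A t by move=> r [/andP[]].
have hA : has_sup A by split; [exists r0|exists t].
pose rho := sup A.
have srho : s < rho by apply: (lt_le_trans sr0); apply: ub_le_sup => //; exists t.
have rhot : rho <= t by apply: ge_sup => //; exists r0.
have grho : good rho.
  move=> x y sx xy yrho; have e0 : 0 < rho - y by rewrite subr_gt0.
  have [r [_ gr]] := sup_adherent e0 hA.
  by rewrite -/rho subKr => yr; exact: gr.
have {}rhot : rho < t.
  rewrite lt_neqAle rhot andbT; apply/eqP => rhoE.
  have [|x y sx xy yr|x [y [sx xy yt]]] := badP ((s + t) / 2).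
  - by apply/andP; split; lra.
  - by apply: grho => //; rewrite rhoE; lra.
  - rewrite ltNge grho// ?rhoE//; [lra|exact: ltW].
have [|x' [y' [rx' xy' yt' far']]] := badP rho _ grho; first by rewrite srho.
have [x1 [rx1 x1y x1far]] : exists x1, [/\ rho < x1, x1 < y' & c < `|f y' - f x1|].
  move: rx'; rewrite le_eqVlt => /predU1P[rx'|rx']; last by exists x'.
  have [|||q [/andP[rq qy] h]] := @far_right R f rho (f y') y' c.
  - by apply: f_right; rewrite (le_trans s0 (ltW srho)) (lt_le_trans rhot tT).
  - by move: xy'; rewrite -rx'.
  - by rewrite distrC; move: far'; rewrite -rx'.
  by exists (ratr q); rewrite rq qy distrC.
have [|x [y [sx xy yx far]]] := not_good x1.
  move=> gx1; have : x1 <= rho.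
    apply: ub_le_sup; first by exists t.
    split=> //; rewrite (lt_trans srho rx1)/=.
    exact: ltW (lt_trans x1y yt').
  by rewrite leNgt rx1.
by exists x, y, x1, y'; rewrite sx xy yx x1y yt'.
Qed.

(** The four times are moved slightly to the right, starting from the last one, so
that each keeps clear of its successor. *)
Lemma double_oscillation_rat (s t c x y x' y' : R) : 0 <= s -> t <= T ->
  [&& s <= x, x < y, y < x', x' < y' & y' < t] ->
  c < `|f y - f x| -> c < `|f y' - f x'| ->
  exists q1 q2 q3 q4 : rat, [/\
    [&& s <= ratr q1, ratr q1 < ratr q2 :> R, ratr q2 < ratr q3 :> R,
      ratr q3 < ratr q4 :> R & ratr q4 < t],
    c < `|f (ratr q2) - f (ratr q1)| & c < `|f (ratr q4) - f (ratr q3)|].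
Proof.
move=> s0 tT /and5P[sx xy yx xy' yt] far far'.
have rc z : s <= z -> z < t -> f x @[x --> z^'+] --> f z.
  by move=> sz zt; apply: f_right; rewrite (le_trans s0 sz) (lt_le_trans zt tT).
have x't := lt_trans xy' yt; have yt' := lt_trans yx x't.
have xt := lt_trans xy yt'; have sy := le_trans sx (ltW xy).
have sx' := le_trans sy (ltW yx); have sy' := le_trans sx' (ltW xy').
have [q4 [/andP[yq4 q4t] h4]] := far_right (rc _ sy' yt) yt far'.
rewrite distrC in h4.
have [q3 [/andP[xq3 q3y] h3]] := far_right (rc _ sx' x't) xy' h4.
have [q2 [/andP[yq2 q2x] h2]] := far_right (rc _ sy yt') yx far.
rewrite distrC in h2.
have [q1 [/andP[xq1 q1y] h1]] := far_right (rc _ sx xt) xy h2.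
exists q1, q2, q3, q4; split; [|by rewrite distrC|by rewrite distrC].
rewrite (le_trans sx (ltW xq1)) (lt_trans q1y yq2) (lt_trans q2x xq3).
by rewrite (lt_trans q3y yq4).
Qed.

(** Conversely, whatever the splitting point [r], one of two separated moves lies
entirely on one side of it; the smaller of the two moves is then a lower bound
for the infimum, which remains strictly above [c]. *)
Lemma modulus_interior_gtP (delta c : R) : 0 < c ->
  (c%:E < modulus_interior T f delta)%E <->
  exists q1 q2 q3 q4 : rat,
    double_oscillation T delta c f (ratr q1) (ratr q2) (ratr q3) (ratr q4).
Proof.
move=> c0; split.
  move=> /ereal_sup_gt[_ [s [t [s0 st tT tsd ->]]] cinf].
  have [|x [y [x' [y' [order far far']]]]] := unsplittable_double s t c s0 st tT c0.
    move=> r rst; apply: (lt_le_trans cinf); apply: ereal_inf_lbound.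
    by exists r => //=; rewrite in_itv.
  have [q1 [q2 [q3 [q4 [/and5P[h1 h2 h3 h4 h5] far1 far2]]]]] :=
    double_oscillation_rat s t c _ _ _ _ s0 tT order far far'.
  exists q1, q2, q3, q4; split => //.
    by rewrite (le_trans s0 h1) h2 h3 h4 (lt_le_trans h5 tT).
  by lra.
move=> [q1 [q2 [q3 [q4]]]].
move: (ratr q1) (ratr q2) (ratr q3) (ratr q4) => x y x' y'.
move=> [/and5P[x0 xy yx xy' yT] yd far far'].
pose t := Num.min T ((y' + (x + delta)) / 2).
have y't : y' < t by rewrite lt_min yT/=; lra.
have td : t < x + delta.
  by apply: (@le_lt_trans _ _ ((y' + (x + delta)) / 2)); [rewrite ge_min lexx orbT|lra].
pose m := Num.min `|f y - f x| `|f y' - f x'|.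
apply: (@lt_le_trans _ _ m%:E); first by rewrite lte_fin lt_min far.
apply: (@le_trans _ _ (ereal_inf [set maxe (oscillation f x r) (oscillation f r t) |
                           r in [set` `]x, t[]])); last first.
  apply: ereal_sup_ubound; exists x, t; split => //; try lra.
  by rewrite ge_min lexx.
apply: le_ereal_inf_tmp => z [r /=]; rewrite in_itv/= => /andP[xr rt] <-.
rewrite le_max; have [yr|ry] := ltP y r; apply/orP; [left|right].
  apply: (@le_trans _ _ `|f y - f x|%:E); first by rewrite lee_fin ge_min lexx.
  by apply: ereal_sup_ubound; exists x, y; split => //; exact: ltW.
apply: (@le_trans _ _ `|f y' - f x'|%:E).
  by rewrite lee_fin ge_min lexx orbT.
apply: ereal_sup_ubound; exists x', y'; split => //; last exact: ltW.
by rewrite (le_trans ry) ?ltW.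
Qed.

End Paths.

(** * Bounding the modulus in probability *)

Section RatGrid.
Context {R : realType} (T : R) (n : nat).

Definition rat_grid : seq R :=
  sort <=%R [seq x <- [seq ratr q | q <- pmap (@unpickle rat) (iota 0 n)] |
               0 <= x <= T].

(** Constant equal to [T] after the last grid point, which keeps it monotone. *)
Definition grid_time i := nth T rat_grid i.

Lemma mem_rat_grid (q : rat) : (pickle q < n)%N -> 0 <= (ratr q : R) <= T ->
  ratr q \in rat_grid.
Proof.
move=> qn qT; rewrite mem_sort mem_filter qT map_f// mem_pmap.
by apply/mapP; exists (pickle q); rewrite ?mem_iota// pickleK.
Qed.

Lemma grid_time_range i : 0 <= T -> 0 <= grid_time i <= T.
Proof.
move=> T0; rewrite /grid_time; have [iG|Gi] := ltnP i (size rat_grid).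
  by have := mem_nth T iG; rewrite mem_sort mem_filter => /andP[].
by rewrite nth_default// T0 lexx.
Qed.

Lemma grid_time_homo : 0 <= T -> {homo grid_time : i j / (i <= j)%N >-> i <= j}.
Proof.
move=> T0 i j ij; have [jG|Gj] := ltnP j (size rat_grid).
  apply: (sorted_leq_nth le_trans le_refl) => //; last first.
    exact: leq_ltn_trans ij jG.
  exact: (sort_sorted (@le_total _ R)).
rewrite {2}/grid_time nth_default//.
by have /andP[] := grid_time_range i T0.
Qed.

Lemma index_rat_grid (x y : R) : 0 <= T -> x \in rat_grid -> y \in rat_grid ->
  x < y -> (index x rat_grid <= index y rat_grid)%N.
Proof.
move=> T0 xG yG; apply: contraTT; rewrite -ltnNge -leNgt => /ltnW.
by move=> /(grid_time_homo T0); rewrite /grid_time !nth_index.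
Qed.

End RatGrid.

Section Modulus.
Context {d : measure_display} {Om : measurableType d} {R : realType}.
Context (P : probability Om R) (T : R) (F : R -> set (set Om)).
Context (Z : R -> Om -> R) (eps : R).
Hypothesis T_gt0 : 0 < T.
Hypothesis F_filtration : is_filtration T F.
Hypothesis Z_adapted : adapted T F Z.
Hypothesis mZ : forall v, measurable_fun setT (Z v).
Hypothesis eps_gt0 : 0 < eps.
Hypothesis Z_right : forall w t, 0 <= t < T ->
  Z x w @[x --> t^'+] --> Z t w.
Hypothesis Z_left : forall w, cvg (Z x w @[x --> T^'-]).

Definition rat_double_oscillation delta n : set Om :=
  [set w | exists q1 q2 q3 q4 : rat,
    [&& pickle q1 < n, pickle q2 < n, pickle q3 < n & pickle q4 < n]%N /\
    double_oscillation T delta (4 * eps) (Z ^~ w)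
      (ratr q1) (ratr q2) (ratr q3) (ratr q4)].

Lemma measurable_rat_double_oscillation delta n :
  measurable (rat_double_oscillation delta n).
Proof.
pose D (q : rat * rat * rat * rat) : set Om :=
  [set w | [&& pickle q.1.1.1 < n, pickle q.1.1.2 < n, pickle q.1.2 < n
    & pickle q.2 < n]%N /\
    double_oscillation T delta (4 * eps) (Z ^~ w)
      (ratr q.1.1.1) (ratr q.1.1.2) (ratr q.1.2) (ratr q.2)].
rewrite (_ : rat_double_oscillation _ _ = \bigcup_q D q); last first.
  apply/seteqP; split => w.
    by move=> [q1 [q2 [q3 [q4 h]]]]; exists (q1, q2, q3, q4).
  by move=> [[[[q1 q2] q3] q4] _ h]; exists q1, q2, q3, q4.
apply: countable_bigcupT_measurable => [|[[[q1 q2] q3] q4]].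
  exact: countableP.
pose b : bool := [&& [&& pickle q1 < n, pickle q2 < n, pickle q3 < n
    & pickle q4 < n]%N,
  [&& 0 <= (ratr q1 : R), (ratr q1 : R) < ratr q2, (ratr q2 : R) < ratr q3,
    (ratr q3 : R) < ratr q4 & ratr q4 < T] & ratr q4 < ratr q1 + delta].
rewrite (_ : D _ = if b then
    [set w | 4 * eps < `|Z (ratr q2) w - Z (ratr q1) w|] `&`
    [set w | 4 * eps < `|Z (ratr q4) w - Z (ratr q3) w|] else set0).
  by case: ifP => // _; apply: measurableI; exact: measurable_far.
apply/seteqP; split => w.
  by move=> [/= h [ord len f1 f2]]; rewrite /b h ord len.
by case: ifP => // /and3P[h ord len] [f1 f2]; split.
Qed.

Lemma interior_event delta :
  [set w | ((4 * eps)%:E < modulus_interior T (Z ^~ w) delta)%E] =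
  \bigcup_n rat_double_oscillation delta n.
Proof.
have e4 : 0 < 4 * eps by rewrite mulr_gt0.
apply/seteqP; split => w.
  move=> /(modulus_interior_gtP _ _ (Z_right w) _ _ e4) [q1 [q2 [q3 [q4 h]]]].
  exists (maxn (maxn (pickle q1) (pickle q2)) (maxn (pickle q3) (pickle q4))).+1 => //.
  exists q1, q2, q3, q4; split => //.
  by rewrite !ltnS !leq_max !leqnn !orbT.
move=> [n _ [q1 [q2 [q3 [q4 [_ h]]]]]].
by apply/(modulus_interior_gtP _ _ (Z_right w) _ _ e4); exists q1, q2, q3, q4.
Qed.

(** The bound on a grid does not depend on the grid, so it passes to the
increasing union over [n] of the events on the first [n] rationals. *)
Lemma prob_interior delta alpha h1 alpha1 :
  0 <= delta -> 0 <= alpha -> small_increments P T F Z eps delta alpha ->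
  0 < h1 -> 0 <= alpha1 -> 4 * alpha1 <= 1 ->
  small_increments P T F Z eps h1 alpha1 ->
  (P [set w | ((4 * eps)%:E < modulus_interior T (Z ^~ w) delta)%E]
   <= (4 * (Num.truncn (T / h1)).+1%:R * alpha)%:E)%E.
Proof.
move=> d0 a0 small h10 a10 a1 small1; have T0 := ltW T_gt0.
rewrite interior_event; apply: nondecreasing_bigcup_le => [n|m n mn|n].
- exact: measurable_rat_double_oscillation.
- move=> w [q1 [q2 [q3 [q4 [/and4P[b1 b2 b3 b4] h]]]]].
  exists q1, q2, q3, q4; split => //.
  by rewrite !(leq_trans _ mn).
have mD := measurable_rat_double_oscillation delta n.
rewrite (probE P _ mD) lee_fin.
have := grid_two_oscillations _ _ _ P _ _ _ _ _ F_filtration Z_adapted mZ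
  (ltW eps_gt0) (grid_time_homo T n T0) (fun i => grid_time_range T n i T0)
  (size (rat_grid T n)) _ _ _ _ _ d0 a0 small h10 a10 a1 small1 mD.
apply.
move=> w [q1 [q2 [q3 [q4 [/and4P[n1 n2 n3 n4]]]]]].
have inG q : (pickle q < n)%N -> 0 <= (ratr q : R) -> (ratr q : R) < T ->
    (ratr q : R) \in rat_grid T n.
  by move=> qn q0 qT; apply: mem_rat_grid => //; rewrite q0 ltW.
move: (inG _ n1) (inG _ n2) (inG _ n3) (inG _ n4).
move: (ratr q1 : R) (ratr q2 : R) (ratr q3 : R) (ratr q4 : R) => x y x' y' gx gy gx' gy'.
move=> [/and5P[x0 xy yx xy' yT] yd far far'].
have x'T := lt_trans xy' yT; have y0 := le_trans x0 (ltW xy).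
have x'0 := le_trans y0 (ltW yx); have y'0 := le_trans x'0 (ltW xy').
have yT' := lt_trans yx x'T; have xT := lt_trans xy yT'.
have {}gx := gx x0 xT; have {}gy := gy y0 yT'.
have {}gx' := gx' x'0 x'T; have {}gy' := gy' y'0 yT.
exists (index x (rat_grid T n)), (index y (rat_grid T n)).
exists (index x' (rat_grid T n)), (index y' (rat_grid T n)).
rewrite /grid_time !nth_index//; split => //.
by rewrite index_size andbT; apply/and3P; split; exact: index_rat_grid.
Qed.

Lemma small_increments_setT h alpha u v :
  small_increments P T F Z eps h alpha -> 0 <= u <= T -> u <= v <= u + h ->
  fine (P [set w | eps < `|Z v w - Z u w|]) <= alpha.
Proof.
move=> small uT uv; have [sF _ _] := F_filtration; have [F0 FC _] := sF _ uT.
have FT : F u setT by rewrite -(setD0 setT); exact: FC.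
by have := small _ _ _ uT uv FT; rewrite setIT probability_setT mulr1.
Qed.

Definition far_event (u v : R) := [set w | 4 * eps < `|Z v w - Z u w|].

Lemma far_event_le h alpha u v :
  small_increments P T F Z eps h alpha -> 0 <= u <= T -> u <= v <= u + h ->
  (P (far_event u v) <= alpha%:E)%E.
Proof.
move=> small uT uv.
rewrite probE; last exact: measurable_far.
rewrite lee_fin; apply: le_trans (small_increments_setT _ _ _ _ small uT uv).
apply: prob_mono; [exact: measurable_far|exact: measurable_far|].
by move=> w; apply: le_lt_trans; move: eps_gt0; lra.
Qed.

Definition left_end_event delta :=
  [set w | 4 * eps < `|lim (Z x w @[x --> T^'-]) - Z (T - delta) w|].

(** The times [T - delta / n.+1] increase to [T] and lie within [delta] after
[T - delta].  If the limit at [T] is far from the value at [T - delta], so are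
the values at all but finitely many of these times, and each of these events has
small probability. *)
Lemma left_end_event_le delta alpha : 0 < delta -> delta <= T -> 
  small_increments P T F Z eps delta alpha ->
  measurable (left_end_event delta) /\ (P (left_end_event delta) <= alpha%:E)%E.
Proof.
move=> d0 dT small.
pose t n : R := T - delta / n.+1%:R.
have tn_lt n : t n < T by rewrite ltrBlDr ltrDl divr_gt0.
have tn_ge n : T - delta <= t n.
  by rewrite lerD2l lerN2 ler_pdivrMr// ler_peMr ?ler1n// ltW.
have t_cvg : t n @[n --> \oo] --> T.
  rewrite -[X in _ --> X]subr0 -[X in _ - X](mulr0 delta); apply: cvgB; first exact: cvg_cst.
  by apply: cvgMr; exact: cvg_harmonic.
have Zt w : Z (t n) w @[n --> \oo] --> lim (Z x w @[x --> T^'-]).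
  have /cvg_at_leftP := Z_left w; apply.
  by split.
have mL : measurable (left_end_event delta).
  apply: measurable_far => //.
  by apply: (measurable_fun_cvg (fun n => mZ (t n))) => w _; exact: Zt.
split => //.
pose B k := \bigcap_(n in [set n | (k <= n)%N]) far_event (T - delta) (t n).
have mB k : measurable (B k).
  by apply: bigcap_measurable => [|n _]; [exists k => /=|exact: measurable_far].
apply: (@le_trans _ _ (P (\bigcup_k B k))).
  apply: le_measure; rewrite ?inE//; first exact: bigcupT_measurable.
  move=> w /= far.
  have : `|Z (t n) w - Z (T - delta) w| @[n --> \oo] -->
      `|lim (Z x w @[x --> T^'-]) - Z (T - delta) w|.
    by apply: cvg_norm; apply: cvgB; [exact: Zt|exact: cvg_cst].
  move=> /cvgr_gt /(_ _ far) [k _ hk].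
  by exists k => // n /= kn; exact: hk.
apply: nondecreasing_bigcup_le => // [m n mn w Bw k /= nk|k].
  by apply: Bw => /=; exact: leq_trans nk.
apply: le_trans (far_event_le _ _ (T - delta) (t k) small _ _).
- apply: le_measure; rewrite ?inE//; first exact: measurable_far.
  by move=> w; apply => /=.
- by rewrite subr_ge0 dT/= lerBlDr lerDl ltW.
- by rewrite tn_ge subrK ltW.
Qed.

Lemma prob_modulus_le delta alpha h1 alpha1 :
  0 < delta -> delta <= T -> 0 <= alpha ->
  small_increments P T F Z eps delta alpha ->
  0 < h1 -> 0 <= alpha1 -> 4 * alpha1 <= 1 ->
  small_increments P T F Z eps h1 alpha1 ->
  (P [set w | ((4 * eps)%:E < modulus T (Z ^~ w) delta)%E]
   <= ((4 * (Num.truncn (T / h1)).+1%:R + 2) * alpha)%:E)%E.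
Proof.
move=> d0 dT a0 small h10 a10 a1 small1.
pose E1 := [set w | ((4 * eps)%:E < modulus_interior T (Z ^~ w) delta)%E].
pose E2 := far_event 0 delta.
pose E3 := left_end_event delta.
have mE1 : measurable E1.
  rewrite /E1 interior_event; apply: bigcupT_measurable => n.
  exact: measurable_rat_double_oscillation.
have mE2 : measurable E2 by exact: measurable_far.
have [mE3 PE3] := left_end_event_le _ _ d0 dT small.
have -> : [set w | ((4 * eps)%:E < modulus T (Z ^~ w) delta)%E] = E1 `|` (E2 `|` E3).
  apply/seteqP; split => w /=; rewrite /modulus !lt_max !lte_fin.
    by case/or3P => ?; [left|right; left|right; right].
  by case=> [h|[h|h]]; apply/or3P; [apply: Or31|apply: Or32|apply: Or33].
apply: (@le_trans _ _ (P E1 + P (E2 `|` E3))%E).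
  by apply: measureU2 => //; exact: measurableU.
apply: (@le_trans _ _ (P E1 + (P E2 + P E3))%E).
  by rewrite leeD2l//; exact: measureU2.
have P1 := prob_interior _ _ _ _ (ltW d0) a0 small h10 a10 a1 small1.
have P2 : (P E2 <= alpha%:E)%E.
  by apply: far_event_le small _ _; rewrite ?add0r ?lexx ?ltW.
apply: (le_trans (leeD P1 (leeD P2 PE3))).
rewrite -!EFinD lee_fin; lra.
Qed.

End Modulus.

(** * Convergence of the modulus *)

Lemma limn_esup_le_near {R : realType} (u : nat -> \bar R) (c : \bar R) :
  (\forall n \near \oo, (u n <= c)%E) -> (limn_esup u <= c)%E.
Proof.
move=> uc; apply: (@le_trans _ _ (ereal_sup (u @` [set n | (u n <= c)%E]))).
  by apply: ereal_inf_lbound; exists [set n | (u n <= c)%E].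
by apply: ge_ereal_sup => _ [n /= unc <-].
Qed.

(** A stopped path has the same value at [v] as at the projection of [v] on the
interval from 0 to [T], where adaptedness applies. *)
Lemma measurable_canonical_process {R : realType} {T : R}
    {F : R -> set (set (skorokhod T))} (v : R) : 0 <= T ->
  is_filtration T F -> adapted T F (canonical_process T) ->
  measurable_fun setT (canonical_process T v : skorokhod T -> R).
Proof.
move=> T0 [_ Fm _] Zad; pose v' := Num.max 0 (Num.min v T).
have v'T : 0 <= v' <= T.
  by rewrite le_max lexx/= ge_max T0 ge_min lexx orbT.
rewrite (_ : canonical_process T v = canonical_process T v'); last first.
  by apply/funext => z; exact: path_stopped.
by move=> _ B mB; rewrite setTI; apply: (Fm _ v'T); exact: Zad.
Qed.

(** Monotonicity of [psi] is what makes the bound uniform over shorter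
increments. *)
Lemma small_increments_of_cond_prob (d : measure_display)
    (Om : measurableType d) (R : realType) (P : probability Om R) (T : R)
    (F : R -> set (set Om)) (Z : R -> Om -> R) (eps h0 : R) (psi : R -> R) :
  is_filtration T F -> (forall v, measurable_fun setT (Z v)) ->
  (forall h, 0 <= h <= h0 -> 0 <= psi h) ->
  (forall h h', 0 <= h -> h <= h' -> h' <= h0 -> psi h <= psi h') ->
  (forall h t, 0 <= h <= h0 -> 0 <= t <= T ->
    cond_prob_le P (F t) [set z | eps < `|Z (t + h) z - Z t z|] (psi h)) ->
  forall h, 0 <= h <= h0 -> small_increments P T F Z eps h (psi h).
Proof.
move=> [_ Fm _] mZ psi0 psi_homo cond h /andP[h_ge0 hh0] u v B uT /andP[uv vh] FB.
have k0 : 0 <= v - u by rewrite subr_ge0.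
have kh : v - u <= h by rewrite lerBlDl.
have kh0 : 0 <= v - u <= h0 by rewrite k0 (le_trans kh).
have := cond _ _ kh0 uT; rewrite addrC subrK => c.
have mA : measurable [set w | eps < `|Z v w - Z u w|] by exact: measurable_far.
apply: le_trans (cond_prob_le_setI P _ _ _ _ (Fm _ uT) mA FB (psi0 _ kh0) c) _.
by apply: ler_wpM2r; [exact: prob_ge0|exact: psi_homo].
Qed.

Theorem theoremB4 (R : realType) (T : R) (T_gt0 : 0 < T)
    (P : nat -> probability (skorokhod T) R)
    (F : nat -> R -> set (set (skorokhod T)))
    (F_filtration : forall N, is_filtration T (F N))
    (Z_adapted : forall N, adapted T (F N) (canonical_process T)) :
  (forall eps : R, 0 < eps ->
    forall (h0 : R) (N0 : nat) (psi : R -> R) (psiN : nat -> R -> R)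
      (phi : nat -> R),
    0 < h0 ->
    (forall h, 0 <= h <= h0 -> 0 <= psi h) ->
    (forall N h, (N0 <= N)%N -> 0 <= h <= h0 -> 0 <= psiN N h) ->
    (forall N, (N0 <= N)%N -> 0 <= phi N) ->
    (forall N, (N0 <= N)%N ->
      forall h h', 0 <= h -> h <= h' -> h' <= h0 -> psiN N h <= psiN N h') ->
    (forall N, (N0 <= N)%N ->
      forall h t, 0 <= h <= h0 -> 0 <= t <= T ->
      cond_prob_le (P N) (F N t)
        [set z | eps < `|canonical_process T (t + h) z - canonical_process T t z|]
        (psiN N h)) ->
    (forall N, (N0 <= N)%N ->
      forall h, 0 <= h <= h0 -> psiN N h <= psi h + phi N) ->
    phi N @[N --> \oo] --> 0 ->
    psi h @[h --> 0^'+] --> 0 ->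
    limn_esup (fun N => P N [set z |
        ((4 * eps)%:E < modulus T (canonical_process T ^~ z) delta)%E])
      @[delta --> 0^'+] --> 0%E) /\
  ((forall eps : R, 0 < eps ->
      limn_esup (fun N => P N [set z |
          ((4 * eps)%:E < modulus T (canonical_process T ^~ z) delta)%E])
        @[delta --> 0^'+] --> 0%E) ->
   forall eps : R, 0 < eps ->
      limn_esup (fun N => P N [set z |
          (eps%:E < modulus T (canonical_process T ^~ z) delta)%E])
        @[delta --> 0^'+] --> 0%E).
Proof.
split; last first.
  move=> H eps eps0; have := H (eps / 4).
  by rewrite mulrCA divff ?mulr1//; apply; rewrite divr_gt0.
move=> eps eps0 h0 N0 psi psiN phi h00 psi0 psiN0 phi0 psiN_homo cond psiN_le
  phi_cvg psi_cvg.
have mZ N v := measurable_canonical_process v (ltW T_gt0) (F_filtration N) (Z_adapted N).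
have small N : (N0 <= N)%N -> forall h, 0 <= h <= h0 ->
    small_increments (P N) T (F N) (canonical_process T) eps h (psiN N h).
  move=> N0N; apply: small_increments_of_cond_prob => //.
  - exact: mZ N.
  - by move=> h hh; exact: psiN0.
  - exact: psiN_homo.
  - exact: cond.
(* With [phi N <= 8^-1] as well, this gives [4 * psiN N h1 <= 1]. *)
have [h1 [h10 h1h0 psih1]] : exists h1, [/\ 0 < h1, h1 <= h0 & psi h1 <= 8^-1].
  have near_h0 : \forall h \near 0^'+, h <= h0 by exact: nbhs_right_le.
  have near_psi : \forall h \near 0^'+, psi h <= 8^-1.
    by move: psi_cvg => /cvgr_le; apply; rewrite invr_gt0.
  have [q q0 [qh qpsi]] := rat_near_right (filterI near_h0 near_psi).
  by exists (ratr q).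
have h1_range : 0 <= h1 <= h0 by rewrite ltW.
pose K : R := 4 * (Num.truncn (T / h1)).+1%:R + 2.
have K0 : 0 < K by rewrite ltr_wpDl// mulr_ge0.
have bound : \forall N \near \oo, forall delta, 0 < delta -> delta <= T ->
    delta <= h0 ->
    (P N [set z |
        ((4 * eps)%:E < modulus T (canonical_process T ^~ z) delta)%E] <=
      (K * (psi delta + phi N))%:E)%E.
  have near_phi : \forall N \near \oo, phi N <= 8^-1.
    by move: phi_cvg => /cvgr_le; apply; rewrite invr_gt0.
  near=> N => delta d0 dT dh0.
  have N0N : (N0 <= N)%N by near: N; exact: nbhs_infty_ge.
  have phiN : phi N <= 8^-1 by near: N.
  have d_range : 0 <= delta <= h0 by rewrite ltW.
  have psiN1 : 4 * psiN N h1 <= 1 by have := psiN_le N N0N h1 h1_range; lra.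
  apply: (@le_trans _ _ (K * psiN N delta)%:E); last first.
    by rewrite lee_fin ler_pM2l// psiN_le.
  apply: (prob_modulus_le (P N) T (F N) _ _ T_gt0 (F_filtration N) (Z_adapted N)
    (mZ N) eps0 _ _ _ _ _ _ d0 dT _ (small N N0N _ d_range) h10 _ psiN1
    (small N N0N _ h1_range)).
  - by move=> z t tT; exact: path_right_cont.
  - by move=> z; apply: path_left_lim; rewrite T_gt0 lexx.
  - exact: psiN0.
  - exact: psiN0.
apply: (@squeeze_cvge _ _ _ _ (cst 0%E) _ (fun delta => (K * psi delta)%:E)).
- have near_d : \forall delta \near 0^'+, [/\ 0 < delta, delta <= T & delta <= h0].
    near=> delta; split; near: delta; first exact: nbhs_right_gt.
      exact: nbhs_right_le.
    exact: nbhs_right_le.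
  apply: filterS near_d => delta [d0 dT dh0]; apply/andP; split.
    exact: limf_esup_ge0.
  apply/lee_addgt0Pr => e e0; apply: limn_esup_le_near.
  have near_phi : \forall N \near \oo, phi N <= e / K.
    by move: phi_cvg => /cvgr_le; apply; rewrite divr_gt0.
  apply: filterS2 bound near_phi => N bN phiN.
  apply: le_trans (bN _ d0 dT dh0) _.
  by rewrite -EFinD lee_fin mulrDr lerD2l mulrC -ler_pdivlMr.
- exact: cvg_cst.
- apply: cvg_EFin; first exact: nearW.
  rewrite -[X in _ --> X](mulr0 K); exact: cvgMr.
Unshelve. all: by end_near. Qed.
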